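(* Let $q$ be a prime power, $\ell\ge 0$ and $t\ge 0$ integers, $Q\in\mathbb F_q[x]$ a monic polynomial of degree $t$, $\varepsilon\in\mathcal E^{\ell,Q}$ a Hayes equivalence class, and $D\subseteq\mathbb F_q$ a set containing no zero of $Q$, with $n:=|D|$. Let $Y_k(\varepsilon)$ be the number of distinct zeros lying in $D$ of a uniformly random polynomial $f\in\mathcal M_{k+t+\ell}(\varepsilon)$. Let $r\ge 0$ be an integer. (a) As $k-r\to\infty$, $$\mathbb P(Y_k(\varepsilon)=r)\sim \binom{n}{r}\left(\frac1q\right)^{r}\left(1-\frac1q\right)^{n-r}.$$ (b) As $n\to\infty$ and $k-r\to\infty$, with $r=o(\sqrt n)$, $$\mathbb P(Y_k(\varepsilon)=r)\sim e^{-n/q}\,\frac{1}{r!}\left(\frac{n}{q}\right)^{r}.$$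
   Context: $\mathcal M$ is the set of monic polynomials over the finite field $\mathbb F_q$, and $\mathcal M_d$ the set of those of degree $d$. For $f\in\mathcal M$ put $\hat f(x)=x^{\deg f}f(1/x)$. Fix an integer $\ell\ge 0$ and $Q\in\mathcal M$. Two polynomials $f,g\in\mathcal M$ are Hayes equivalent with respect to $\ell$ and $Q$ if $\gcd(f,Q)=\gcd(g,Q)=1$, $\hat f\equiv\hat g \pmod{x^{\ell+1}}$ and $f\equiv g\pmod Q$. $\mathcal E^{\ell,Q}$ denotes the set of equivalence classes (of monic polynomials coprime to $Q$); it is a finite abelian group under $\langle f\rangle\langle g\rangle=\langle fg\rangle$. For $\varepsilon\in\mathcal E^{\ell,Q}$, $\mathcal M_{d}(\varepsilon)$ is the set of polynomials in $\mathcal M_d$ belonging to the class $\varepsilon$ (for $k\ge0$ and $t=\deg Q$ one has $|\mathcal M_{k+t+\ell}(\varepsilon)|=q^k$). The asymptotic statements concern sequences of parameters $(q,\ell,Q,\varepsilon,D,k,r)$ along which the indicated quantities behave as stated; $a\sim b$ means $a=(1+o(1))b$. *)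

(* Defs.v *)
From HB Require Import structures.
From mathcomp Require Export all_boot all_order all_algebra.
From mathcomp Require Export all_classical all_reals all_analysis.
Export numFieldNormedType.Exports.
Import Order.TTheory GRing.Theory Num.Theory.

Set Implicit Arguments.
Unset Strict Implicit.
Unset Printing Implicit Defensive.

Local Open Scope classical_set_scope.
Local Open Scope ring_scope.

(* x^(deg f) f(1/x), expanded monomial by monomial. *)
Definition recip_poly (F : finFieldType) (f : {poly F}) : {poly F} :=
  \sum_(i < size f) f`_i *: 'X^((size f).-1 - i).

Definition hayes_equiv (F : finFieldType) (ell : nat) (Q f g : {poly F}) : Prop :=
  [/\ f \is monic /\ g \is monic,
      coprimep f Q /\ coprimep g Q,
      'X^(ell.+1) %| recip_poly f - recip_poly g
    & Q %| f - g].

Definition hayes_classes (F : finFieldType) (ell : nat) (Q : {poly F}) :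
    set (set {poly F}) :=
  [set eps | exists f : {poly F},
     [/\ f \is monic, coprimep f Q & eps = [set g | hayes_equiv ell Q f g]]].

(* {poly_d.+1 F} is the finite type of polynomials of degree at most d. *)
Definition class_polys (F : finFieldType) (d : nat) (eps : set {poly F}) :
    {set {poly_d.+1 F}} :=
  [set f : {poly_d.+1 F} | [&& (f : {poly F}) \is monic,
                               size (f : {poly F}) == d.+1
                             & (f : {poly F}) \in eps]]%SET.

Definition num_zeros (F : finFieldType) (D : {set F}) (f : {poly F}) : nat :=
  #|[set a in D | root f a]%SET|.

Definition prob_num_zeros (R : realType) (F : finFieldType) (d : nat)
    (eps : set {poly F}) (D : {set F}) (r : nat) : R :=
  #|[set f in class_polys d eps | num_zeros D (f : {poly F}) == r]%SET|%:R
  / #|class_polys d eps|%:R.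

(* Main.v *)
(* For a set S of j <= k points of D, the polynomials of the class that vanish on S
   are the f of degree k + t + ell with ell + 1 prescribed leading coefficients and
   a prescribed residue modulo Q * prod_(a in S) (X - a); there are exactly q^(k-j)
   of them.  The factorial moments of Y of order j <= k are therefore those of a
   binomial variable with parameters n and 1/q.  Bonferroni's inequalities truncated
   at order k compare P(Y = r) with the same truncation of the binomial expansion of
   (1 - 1/q)^(n-r); both errors are at most binom(n,r) q^-r / (k-r)!, because
   n - r <= q, while (1 - 1/q)^(n-r) >= e^-2.  This gives (a) with relative error
   2 e^2 / (k-r)!.  Part (b) then follows from (n)_r / n^r >= 1 - r^2/n and
   exp(- x - 2 x^2) <= 1 - x <= exp(- x) at x = 1/q <= 1/n. *)
Require Import Defs.
From mathcomp Require Import ring lra zify.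
Import Order.TTheory GRing.Theory Num.Theory.
Local Open Scope classical_set_scope.
Local Open Scope ring_scope.

Set Implicit Arguments.
Unset Strict Implicit.
Unset Printing Implicit Defensive.

(** * Coefficients of reciprocal polynomials, and a binomial identity *)

Lemma dvdp_XnP (F : fieldType) (m : nat) (p : {poly F}) :
  reflect (forall i, (i < m)%N -> p`_i = 0) ('X^m %| p).
Proof.
apply: (iffP idP) => [/dvdpP[u ->] i im|p0].
  by rewrite coefMXn im.
rewrite -[p](poly_take_drop m) (_ : take_poly m p = 0) ?add0r ?dvdp_mull//.
apply/polyP => i; rewrite coef_take_poly coef0.
by case: ifP => // /p0.
Qed.

Lemma recip_polyE (F : finFieldType) (f : {poly F}) :
  recip_poly f = \poly_(i < size f) f`_((size f).-1 - i).
Proof.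
rewrite /recip_poly poly_def (reindex_inj rev_ord_inj) /=.
apply: eq_bigr => i _; have := ltn_ord i.
by move=> ilt; congr (_`_ _ *: 'X^ _); lia.
Qed.

(** Multiplied by a! b! (m-a-b)!, both sides become m!; when a + b > m both vanish. On the right [m]
    enters through a single binomial coefficient, so factorial moments apply. *)
Lemma mul_bin_bin (m a b : nat) :
  ('C(m, a) * 'C(m - a, b) = 'C(m, a + b) * 'C(a + b, a))%N.
Proof.
have [abm|mab] := leqP (a + b) m; last first.
  have [am|ma] := leqP a m; last by rewrite (bin_small ma) (bin_small mab).
  by rewrite (bin_small mab) (bin_small (_ : m - a < b)%N) ?muln0//; lia.
have h1 := @bin_fact m a ltac:(lia); have h2 := @bin_fact (m - a) b ltac:(lia).
have h3 := bin_fact abm; have h4 := @bin_fact (a + b) a ltac:(lia).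
rewrite addKn in h4; rewrite -subnDA in h2.
apply/eqP; rewrite -(eqn_pmul2r (_ : 0 < a`! * (b`! * (m - (a + b))`!)))%N; last first.
  by rewrite !muln_gt0 !fact_gt0.
apply/eqP; transitivity m`!.
  by rewrite -[RHS]h1 -h2; ring.
by rewrite -[LHS]h3 -h4; ring.
Qed.

(** * Counting the members of a class with prescribed zeros *)

Section HayesClass.
Variables (F : finFieldType) (ell t k : nat) (Q f0 : {poly F}).
Hypotheses (Qmonic : Q \is monic) (Qdeg : size Q = t.+1).
Hypotheses (f0monic : f0 \is monic) (f0Q : coprimep f0 Q).

Local Notation d := (k + t + ell)%N.

(* [f], of degree [d], satisfies the condition modulo ['X^ell.+1] exactly when its
   [ell.+1] leading coefficients are those of [leading_part]. *)
Definition leading_part : {poly F} :=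
  \poly_(i < d.+1) (if (k + t <= i)%N then (recip_poly f0)`_(d - i) else 0).

(** For [f] of degree d, coefficient i of [recip_poly f] is coefficient d - i of [f], so the
    congruence fixes the coefficients from k + t up to d. The top one is the constant term 1 of
    [recip_poly f0], which forces [f] to be monic of degree d; coprimality with [Q] is inherited
    from [f0]. *)
Lemma class_polysE (f : {poly_(d.+1) F}) :
  (f \in class_polys d [set g | hayes_equiv ell Q f0 g]) =
  (size ((f : {poly F}) - leading_part)%R <= k + t)%N
    && (Q %| (f : {poly F}) - f0).
Proof.
have f0s : size f0 != 0%N by rewrite size_poly_eq0 monic_neq0.
have r0 : (recip_poly f0)`_0 = 1.
  by rewrite recip_polyE coef_poly lt0n f0s subn0 -lead_coefE (monicP f0monic).
rewrite inE; apply/and3P/andP => [[fmon /eqP fs]|[/leq_sizeP fT Qf]].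
  rewrite inE /= => -[_ _ /dvdp_XnP eqf]; rewrite -dvdpNr opprB => Qf.
  split=> //; apply/leq_sizeP => j kj; rewrite coefB coef_poly ltnS kj.
  case: leqP => [jd|dj]; last by rewrite subr0 nth_default ?fs.
  have /eqf : (d - j < ell.+1)%N by lia.
  rewrite coefB => /subr0_eq ->; rewrite [recip_poly f]recip_polyE fs coef_poly.
  by rewrite ifT; [apply/subr0_eq; rewrite subKn ?subrr|lia].
have fE j : (k + t <= j <= d)%N -> f`_j = (recip_poly f0)`_(d - j).
  move=> /andP[kj jd]; have := fT _ kj.
  by rewrite coefB coef_poly ltnS jd kj => /subr0_eq.
have fd : f`_d = 1 by rewrite fE ?subnn// leqnn leq_addr.
have fs : size f = d.+1.
  apply/eqP; rewrite eqn_leq size_npoly/= ltnNge; apply/negP => /leq_sizeP.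
  by move=> /(_ _ (leqnn _)) f0'; move: fd; rewrite f0' => /esym/eqP; rewrite oner_eq0.
have fmon : (f : {poly F}) \is monic by rewrite monicE lead_coefE fs fd.
split=> //; first by rewrite fs.
rewrite inE /=; split=> //.
- split=> //; rewrite -(subrK f0 (f : {poly F})).
  have /dvdpP[u ->] := Qf.
  by rewrite coprimep_sym coprimep_addl_mul coprimep_sym.
- apply/dvdp_XnP => i il; rewrite coefB [recip_poly f]recip_polyE fs coef_poly.
  rewrite ifT ?fE ?subKn ?subrr//; lia.
- by rewrite -dvdpNr opprB.
Qed.

(** The Chinese remainder theorem merges the conditions modulo [P] and [Q] into one modulo
    [M = P * Q], of degree j + t. The solutions are [T + (c + M * w)] with [w] an arbitrary
    polynomial having k - j coefficients. *)
Lemma card_class_polys_dvdp (j : nat) (P : {poly F}) :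
  size P = j.+1 -> coprimep P Q -> (j <= k)%N ->
  #|[set f in class_polys d [set g | hayes_equiv ell Q f0 g]
     | P %| (f : {poly F})]%SET| = (#|F| ^ (k - j))%N.
Proof.
move=> Ps PQ jk; set T := leading_part; pose M := P * Q.
(* A Bezout relation makes [u.1 * P] congruent to 1 modulo [Q], whence the witness
   [f0 * (u.1 * P)]. *)
have [h hP hQ] : exists2 h, P %| h & Q %| h - f0.
  have /Bezout_eq1_coprimepP[u uE] := PQ.
  exists (f0 * (u.1 * P)); first by rewrite mulrA dvdp_mull.
  suff -> : f0 * (u.1 * P) - f0 = - f0 * u.2 * Q by rewrite dvdp_mull.
  by rewrite -[X in _ - X]mulr1 -uE; ring.
have P0 : P != 0 by rewrite -size_poly_eq0 Ps.
have Q0 : Q != 0 by exact: monic_neq0.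
have M0 : M != 0 by rewrite mulf_neq0.
have Ms : size M = (j + t).+1 by rewrite size_mul// Ps Qdeg addSn addnS.
have Ts : (size T <= d.+1)%N by exact: size_poly.
have inM (f : {poly_(d.+1) F}) :
    (f \in [set f in class_polys d [set g | hayes_equiv ell Q f0 g]
            | P %| (f : {poly F})]%SET) =
    (size ((f : {poly F}) - T)%R <= k + t)%N && (M %| (f : {poly F}) - h).
  rewrite inE class_polysE -andbA; congr (_ && _).
  rewrite /M Gauss_dvdp// (dvdp_subl _ hP) andbC; congr (_ && _).
  have -> : (f : {poly F}) - f0 = ((f : {poly F}) - h) + (h - f0) by rewrite subrKA.
  by rewrite (dvdp_addl _ hQ).
(* Reduction modulo [M] keeps [c] of size at most j + t <= k + t, so adding it leaves the prescribed
   leading coefficients intact. *)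
pose c := (h - T) %% M.
have cs : (size c <= j + t)%N by rewrite -ltnS -Ms ltn_modp.
have ws (w : {poly_(k - j) F}) : (size (c + M * w)%R <= k + t)%N.
  rewrite (leq_trans (size_polyD _ _))// geq_max (leq_trans cs) ?leq_add2r//=.
  have [->|w0] := eqVneq (w : {poly F}) 0; first by rewrite mulr0 size_poly0.
  rewrite size_mul// Ms addSn/=; rewrite (leq_trans (leq_add (leqnn _) (size_npoly w)))//; lia.
pose phi (w : {poly_(k - j) F}) : {poly_(d.+1) F} := npolyp d.+1 (T + (c + M * w)).
have phiE w : phi w = T + (c + M * w) :> {poly F}.
  rewrite npolypK// (leq_trans (size_polyD _ _))// geq_max Ts/=.
  by rewrite (leq_trans (ws w))//; lia.
have phi_inj : injective phi.
  move=> v w /(congr1 (fun f : {poly_(d.+1) F} => (f : {poly F}))).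
  by rewrite !phiE => /addrI/addrI/(mulfI M0)/val_inj.
rewrite -card_npoly -(card_imset _ phi_inj); apply: eq_card => f.
rewrite inM; apply/andP/imsetP => [[fs Mf]|[w _ ->]]; last first.
  rewrite phiE addrC addKr; split; first exact: ws.
  have -> : T + (c + M * (w : {poly F})) - h = M * (w : {poly F}) - (h - T - c).
    by ring.
  apply: dvdp_sub; first exact: dvdp_mulr.
  by rewrite {1}(divp_eq (h - T) M) addrK dvdp_mull.
(* Conversely, [w] is the quotient of [f - T] by [M]; the remainder is [c] because [f] and [h] agree
   modulo [M]. *)
have wsz : (size (((f : {poly F}) - T) %/ M)%R <= k - j)%N.
  by rewrite size_divp// Ms leq_subLR (leq_trans fs)//; lia.
exists (NPoly (wsz : _ \is a poly_of_size _)) => //; apply: val_inj => /=.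
rewrite phiE /= mulrC addrC [c + _]addrC /c.
suff -> : (h - T) %% M = ((f : {poly F}) - T) %% M by rewrite -divp_eq subrK.
apply/eqP; rewrite eq_sym -subr_eq0 -modpN -modpD.
by rewrite opprB addrA subrK -[_ == _]/(M %| _).
Qed.

Local Notation hclass := (class_polys d [set g | hayes_equiv ell Q f0 g]).

Lemma card_class_polys : #|hclass| = (#|F| ^ k)%N.
Proof.
have := @card_class_polys_dvdp 0 1 (size_poly1 F) (coprime1p _) (leq0n k).
rewrite subn0 => <-; apply: eq_card => f.
by rewrite [RHS]inE dvd1p andbT.
Qed.

Variable D : {set F}.
Hypothesis DQ : forall a, a \in D -> ~~ root Q a.

Lemma card_class_polys_roots (S : {set F}) :
  S \subset D -> (#|S| <= k)%N ->
  #|[set f in hclass | S \subset [set a in D | root (f : {poly F}) a]]%SET|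
  = (#|F| ^ (k - #|S|))%N.
Proof.
move=> SD Sk; pose P : {poly F} := \prod_(a <- enum S) ('X - a%:P).
have Ps : size P = #|S|.+1 by rewrite size_prod_XsubC -cardE.
have PQ : coprimep P Q.
  rewrite /P big_seq; apply: (big_ind (fun p => coprimep p Q)) => [|p p' pQ p'Q|a].
  - exact: coprime1p.
  - by rewrite coprimepMl pQ.
  - by rewrite mem_enum => /(fintype.subsetP SD)/DQ; rewrite coprimep_sym coprimep_XsubC.
rewrite -(card_class_polys_dvdp Ps PQ Sk); apply: eq_card => f.
rewrite !inE; congr (_ && _); apply/fintype.subsetP/idP => [Sf|Pf a aS].
  apply: uniq_roots_dvdp; last by rewrite uniq_rootsE enum_uniq.
  by apply/allP => a; rewrite mem_enum => /Sf; rewrite inE => /andP[].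
rewrite inE (fintype.subsetP SD)//= -dvdp_XsubCl (dvdp_trans _ Pf)//.
by rewrite /P (big_rem a) ?mem_enum//= dvdp_mulr.
Qed.

(** Double counting of the pairs (f, S) with S a j-element set of zeros of f in [D]: each S
    contributes q^(k-j). Divided by q^k, this is the factorial moment of order j over j!. *)
Lemma sum_bin_num_zeros (j : nat) : (j <= k)%N ->
  (\sum_(f in hclass) 'C(num_zeros D (f : {poly F}), j)
   = 'C(#|D|, j) * #|F| ^ (k - j))%N.
Proof.
move=> jk; pose Z (f : {poly_(d.+1) F}) : {set F} :=
  [set a in D | root (f : {poly F}) a].
have binE (f : {poly_(d.+1) F}) : 'C(num_zeros D (f : {poly F}), j) =
    (\sum_(S : {set F} | (S \subset D) && (#|S| == j)) (S \subset Z f))%N.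
  rewrite /num_zeros -cards_draws -sum1_card big_mkcond [RHS]big_mkcond /=.
  apply: eq_bigr => S _; rewrite inE -/(Z f).
  have ZD : Z f \subset D by apply/fintype.subsetP => a; rewrite inE => /andP[].
  case: (boolP (S \subset Z f)) => [/fintype.subset_trans/(_ ZD) ->|_] /=.
    by case: (_ == _).
  by rewrite if_same.
under eq_bigr do rewrite binE.
rewrite exchange_big /= -cards_draws -sum1_card big_distrl /=.
rewrite [RHS](eq_bigl (fun S : {set F} => (S \subset D) && (#|S| == j))); last first.
  by move=> S; rewrite inE.
apply: eq_bigr => S /andP[SD /eqP Sj].
rewrite mul1n -Sj -card_class_polys_roots ?Sj// -sum1_card big_mkcond /=.
rewrite [RHS]big_mkcond /=; apply: eq_bigr => f _.
by rewrite [X in _ = if X then _ else _]inE; case: (f \in hclass); case: (S \subset _).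
Qed.

Lemma sum_bin_bin_num_zeros (r i : nat) : (r + i <= k)%N ->
  (\sum_(f in hclass) 'C(num_zeros D (f : {poly F}), r)
                      * 'C(num_zeros D (f : {poly F}) - r, i)
   = 'C(#|D|, r) * 'C(#|D| - r, i) * #|F| ^ (k - (r + i)))%N.
Proof.
move=> rik; under eq_bigr do rewrite mul_bin_bin.
by rewrite -big_distrl/= sum_bin_num_zeros// mul_bin_bin mulnAC.
Qed.

End HayesClass.

(** * Truncated expansions and their error terms *)

(** By Pascal's rule the error E(N, s) satisfies E(N+1, s+1) = E(N, s+1) - x E(N, s), and the
    claimed bounds add up by the same rule. *)
Lemma truncated_binomial (R : realDomainType) (x : R) (N s : nat) :
  0 <= x <= 1 ->
  `|(1 - x) ^+ N - \sum_(i < s) 'C(N, i)%:R * (- x) ^+ i| <= 'C(N, s)%:R * x ^+ s.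
Proof.
move=> /andP[x0 x1]; have y0 : 0 <= 1 - x by rewrite subr_ge0.
have y1 : 1 - x <= 1 by rewrite lerBlDr lerDl.
elim: N s => [|N IH] [|s].
- by rewrite big_ord0 subr0 expr0 bin0 mulr1 normr1.
- by rewrite big_ord_recl big1 => [|i _]; rewrite ?bin0n ?mul0r// expr0 mulr1 addr0 subrr normr0.
- by rewrite big_ord0 subr0 bin0 mulr1 ger0_norm ?exprn_ge0// exprn_ile1.
have -> : (1 - x) ^+ N.+1 - \sum_(i < s.+1) 'C(N.+1, i)%:R * (- x) ^+ i =
    ((1 - x) ^+ N - \sum_(i < s.+1) 'C(N, i)%:R * (- x) ^+ i)
    - x * ((1 - x) ^+ N - \sum_(i < s) 'C(N, i)%:R * (- x) ^+ i).
  have -> : \sum_(i < s.+1) 'C(N.+1, i)%:R * (- x) ^+ i =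
      \sum_(i < s.+1) 'C(N, i)%:R * (- x) ^+ i
      - x * \sum_(i < s) 'C(N, i)%:R * (- x) ^+ i.
    rewrite big_ord_recl [X in _ = X - _]big_ord_recl !bin0 -addrA; congr (_ + _).
    rewrite mulr_sumr -sumrB; apply: eq_bigr => i _.
    by rewrite binS natrD exprS; ring.
  by rewrite exprS; ring.
rewrite (le_trans (ler_normB _ _))// normrM (ger0_norm x0) binS natrD mulrDl.
by rewrite lerD// exprS mulrCA ler_wpM2l.
Qed.

(* Bonferroni's inequality is the case [x = 1] of [truncated_binomial], in which
   [(1 - x) ^+ N] is the indicator of [N = 0]. *)
Lemma bonferroni (R : realDomainType) (y r s : nat) :
  `|(y == r)%:R - \sum_(i < s) ('C(y, r) * 'C(y - r, i))%:R * (- 1) ^+ i|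
  <= ('C(y, r) * 'C(y - r, s))%:R :> R.
Proof.
have := @truncated_binomial R 1 (y - r) s; rewrite ler01 lexx => /(_ isT).
rewrite subrr expr1n mulr1 => h.
(* For y < r the truncated [y - r] is 0 and the power is 1; the factor ['C(y, r)] makes the product
   vanish. *)
have -> : (y == r)%:R = 'C(y, r)%:R * 0 ^+ (y - r) :> R.
  case: ltngtP => [yr|ry|->]; last by rewrite binn subnn mulr1.
  - by rewrite bin_small ?mul0r.
  - by rewrite expr0n subn_eq0 leqNgt ry mulr0.
under eq_bigr do rewrite natrM -mulrA.
by rewrite -mulr_sumr -mulrBr normrM ger0_norm// natrM ler_wpM2l.
Qed.

(** C(N, s) s! is a falling factorial, at most N^s, and (x N)^s <= 1. *)
Lemma bin_expr_le (R : realFieldType) (x : R) (N s : nat) :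
  0 <= x -> x * N%:R <= 1 -> 'C(N, s)%:R * x ^+ s <= (s`!%:R)^-1.
Proof.
move=> x0 xN; rewrite -[leRHS]mul1r ler_pdivlMr ?ltr0n ?fact_gt0//.
rewrite mulrAC -natrM bin_ffact.
apply: (@le_trans _ _ ((x * N%:R) ^+ s)); last by rewrite exprn_ile1// mulr_ge0.
rewrite exprMn mulrC ler_wpM2l ?exprn_ge0// -natrX ler_nat.
elim: s {xN} N => [|s IH] N; first by rewrite ffactn0 expn0.
case: N => [|N]; first by rewrite ffact0n.
rewrite ffactnS expnS leq_mul//= (leq_trans (IH _))//.
by case: s {IH} => // s; rewrite leq_exp2r.
Qed.

(** * Exponential estimates and the passage from binomial to Poisson *)

(** Passing to inverses, 1/(1 - x) <= 1 + x + 2x^2 <= exp(x + 2x^2), the first because (1 + x +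
    2x^2)(1 - x) = 1 + x^2 (1 - 2x). *)
Lemma expRN_le_1sub (R : realType) (x : R) :
  0 <= x <= 2^-1 -> expR (- (x + 2 * x ^+ 2)) <= 1 - x.
Proof.
move=> /andP[x0 x1]; have y0 : 0 < 1 - x by lra.
rewrite expRN -[leRHS]invrK lef_pV2 ?posrE ?expR_gt0 ?invr_gt0//.
apply: le_trans (expR_ge1Dx _); rewrite -[leLHS]mul1r ler_pdivrMr//.
have : 0 <= x ^+ 2 * (1 - 2 * x) by rewrite mulr_ge0 ?sqr_ge0//; lra.
lra.
Qed.

Lemma expR_le_1D2 (R : realType) (y : R) : 0 <= y <= 2^-1 -> expR y <= 1 + 2 * y.
Proof.
move=> /andP[y0 y1]; have z0 : 0 < 1 - y by lra.
have : 1 - y <= 1 / expR y by rewrite mul1r -expRN expR_ge1Dx.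
rewrite ler_pdivlMr ?expR_gt0// mulrC => h.
rewrite -(ler_pM2r z0); apply: le_trans h _.
have : 0 <= y * (1 - 2 * y) by rewrite mulr_ge0//; lra.
lra.
Qed.

Lemma expR_le_expr_1sub (R : realType) (x : R) (N : nat) :
  0 <= x <= 2^-1 -> expR (- (x + 2 * x ^+ 2) * N%:R) <= (1 - x) ^+ N.
Proof.
by move=> hx; rewrite expRM_natr lerXn2r ?nnegrE ?expR_ge0 ?expRN_le_1sub//; lra.
Qed.

(** With G = (n x)^r / r!, the two quantities are a b G and B G, where a = (n)_r / n^r, b = (1 -
    x)^(n-r) and B = exp(-n x). It remains to bound a and b / B on both sides, with errors of order
    y = r^2/n and 1/n. *)
Lemma binomial_poisson (R : realType) (n r : nat) (x : R)
    (c := expR (- (n%:R * x)) * (1 / r`!%:R) * (n%:R * x) ^+ r) :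
  (1 < n)%N -> (r <= n)%N -> 0 <= x -> x * n%:R <= 1 -> 2 * r%:R ^+ 2 <= n%:R :> R ->
  `|'C(n, r)%:R * x ^+ r * (1 - x) ^+ (n - r) - c|
    <= (2 * r%:R ^+ 2 / n%:R + 2 / n%:R) * c.
Proof.
move=> n1 rn x0 xn r2n.
have n0 : 0 < n%:R :> R by rewrite ltr0n; lia.
have n2 : 2 <= n%:R :> R by rewrite ler_nat.
have xV : x <= n%:R^-1 by rewrite -[leRHS]mul1r ler_pdivlMr.
have nV : n%:R^-1 <= 2^-1 :> R by rewrite lef_pV2 ?posrE.
have r0 : 0 <= r%:R :> R by [].
have rr2 : r%:R <= r%:R ^+ 2 :> R by rewrite -natrX ler_nat -mulnn; case: (r) => // m; rewrite leq_pmull.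
pose y : R := r%:R ^+ 2 / n%:R.
have y0 : 0 <= y by rewrite divr_ge0 ?exprn_ge0.
have y1 : y <= 2^-1 by rewrite ler_pdivrMr//; lra.
have xry : x * r%:R <= y by rewrite mulrC ler_pM.
pose B := expR (- (n%:R * x)); have B0 : 0 <= B by exact: expR_ge0.
pose b := (1 - x) ^+ (n - r).
(* The r missing factors of (1 - x)^n cost at most e^(x r) <= 1 + 2 x r, and x r <= r^2/n. *)
have b_le : b <= (1 + 2 * y) * B.
  apply: (@le_trans _ _ (expR (- x * (n - r)%:R))).
    rewrite expRM_natr lerXn2r ?nnegrE ?expR_ge0//; first by lra.
    by have := expR_ge1Dx (- x).
  rewrite natrB// (_ : - x * _ = x * r%:R + - (n%:R * x)); last by ring.
  rewrite expRD ler_wpM2r//; apply: (@le_trans _ _ (1 + 2 * (x * r%:R))); last by lra.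
  by apply: expR_le_1D2; rewrite mulr_ge0//=; lra.
(* Raising the exponent from n - r to n only lowers the bound; the second-order term 2 x^2 n is at
   most 2 x <= 2/n. *)
have b_ge : (1 - 2 / n%:R) * B <= b.
  have hx : 0 <= x <= 2^-1 by lra.
  apply: le_trans (expR_le_expr_1sub (n - r) hx).
  apply: (@le_trans _ _ (expR (- (x + 2 * x ^+ 2) * n%:R))); last first.
    by rewrite ler_expR ler_wnM2l ?ler_nat ?leq_subr// oppr_le0 addr_ge0// mulr_ge0// sqr_ge0.
  rewrite (_ : - (x + _) * _ = - (2 * x * (x * n%:R)) + - (n%:R * x)); last by ring.
  rewrite expRD ler_wpM2r//; apply: le_trans (expR_ge1Dx _); rewrite lerD2l lerN2.
  rewrite -mulrA ler_wpM2l//; apply: le_trans xV; rewrite -[leRHS]mulr1; exact: ler_wpM2l.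
pose a : R := (n ^_ r)%:R / n%:R ^+ r.
have a1 : a <= 1.
  rewrite ler_pdivrMr ?exprn_gt0// mul1r -natrX ler_nat.
  by elim: (r) => // m IH; rewrite ffactnSr expnSr leq_mul// leq_subr.
(* Each of the r factors of (n)_r is at least n - r, so a >= (1 - r/n)^r; the truncation at order 1
   gives (1 - r/n)^r >= 1 - r^2/n. *)
have a_ge : 1 - y <= a.
  have := @truncated_binomial R (r%:R / n%:R) r 1.
  rewrite divr_ge0//= ler_pdivrMr// mul1r ler_nat => /(_ rn).
  rewrite big_ord1 bin0 expr0 mulr1 bin1 expr1 ler_norml => /andP[h _].
  apply: (@le_trans _ _ ((1 - r%:R / n%:R) ^+ r)).
    by move: h; rewrite /y mulrA -expr2; lra.
  have -> : 1 - r%:R / n%:R = (n - r)%:R / n%:R :> R.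
    by rewrite natrB// mulrBl divff// gt_eqF.
  rewrite expr_div_n ler_wpM2r ?invr_ge0 ?exprn_ge0// -natrX ler_nat.
  elim: (r) => // m IH; rewrite ffactnSr expnSr.
  apply: leq_mul; last exact: leq_sub2l.
  by apply: (leq_trans _ IH); case: m {IH} => // m; rewrite leq_exp2r// leq_sub2l.
pose G : R := 1 / r`!%:R * (n%:R * x) ^+ r.
have G0 : 0 <= G by rewrite mulr_ge0 ?divr_ge0// exprn_ge0// mulr_ge0.
have -> : c = B * G by rewrite /c -mulrA.
have -> : 'C(n, r)%:R * x ^+ r = a * G.
  rewrite /a /G -bin_ffact natrM exprMn; field.
  by rewrite expf_neq0 ?gt_eqF// ltr0n fact_gt0.
have -> : a * G * (1 - x) ^+ (n - r) - B * G = (a * b - B) * G by rewrite /b; ring.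
rewrite normrM (ger0_norm G0) [leRHS]mulrA ler_wpM2r//.
have b0 : 0 <= b by apply: exprn_ge0; lra.
have a0 : 0 <= a by lra.
have nV0 : 0 < n%:R^-1 :> R by rewrite invr_gt0.
have up : a * b <= (1 + 2 * y) * B by apply: le_trans b_le; rewrite ler_piMl.
have low : (1 - y) * ((1 - 2 / n%:R) * B) <= a * b.
  apply: ler_pM => //; first by lra.
  by rewrite mulr_ge0//; lra.
have yB : 0 <= y * B by rewrite mulr_ge0.
have vB : 0 <= B / n%:R by rewrite mulr_ge0// ltW.
have yvB : 0 <= y * B / n%:R by rewrite mulr_ge0// ltW.
have -> : (2 * r%:R ^+ 2 / n%:R + 2 / n%:R) * B = 2 * (y * B) + 2 * (B / n%:R).
  by rewrite /y; ring.
have {}up : a * b <= B + 2 * (y * B) by apply: le_trans up _; lra.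
have {}low : B - y * B - 2 * (B / n%:R) + 2 * (y * B / n%:R) <= a * b.
  by apply: le_trans low; rewrite le_eqVlt; apply/orP; left; apply/eqP; ring.
move: (y * B) (B / n%:R) (y * B / n%:R) (a * b) yB vB yvB up low.
by move=> yB vB yvB ab *; rewrite ler_norml; apply/andP; split; lra.
Qed.

(** * Relative error for the law of the number of zeros, and the limits *)

(** This form of u = v + o(v) has no quotient, so indices where v vanishes, such as those with r > n
    in (a), need no separate case. *)
Lemma equiv_rel_error (R : realType) (u v : nat -> R) :
  (forall e : R, 0 < e -> \forall i \near \oo, `|u i - v i| <= e * `|v i|) ->
  u ~_\oo v.
Proof. by move=> uv; apply/eqaddoP => e /uv. Qed.

Lemma prob_num_zeros_error (R : realType) (F : finFieldType) (ell t k r : nat)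
    (Q : {poly F}) (eps : set {poly F}) (D : {set F})
    (x : R := 1 / #|F|%:R)
    (p : R := 'C(#|D|, r)%:R * x ^+ r * (1 - x) ^+ (#|D| - r)) :
  Q \is monic -> size Q = t.+1 -> hayes_classes ell Q eps ->
  (forall a, a \in D -> ~~ root Q a) -> (r <= k)%N ->
  `|prob_num_zeros R (k + t + ell) eps D r - p|
    <= 2 * expR 2 / (k - r)`!%:R * p.
Proof.
move=> Qmon Qdeg [f0 [f0mon f0Q ->]] DQ rk; set s := (k - r)%N.
have q1 : (1 < #|F|)%N by exact: card_finNzRing_gt1.
have q0 : 0 < #|F|%:R :> R by rewrite ltr0n ltnW.
have qx : #|F|%:R * x = 1 by rewrite /x mul1r divff// gt_eqF.
have x0 : 0 <= x by rewrite divr_ge0.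
have x2 : x <= 2^-1 by rewrite /x mul1r lef_pV2 ?posrE// ler_nat.
have x1 : x <= 1 by lra.
have Nx : x * (#|D| - r)%:R <= 1.
  by rewrite -[leRHS]qx [leRHS]mulrC ler_wpM2l// ler_nat (leq_trans (leq_subr _ _))// max_card.
set n := #|D| in p Nx *; set N := (n - r)%N in p Nx *.
pose A : R := 'C(n, r)%:R * x ^+ r.
have A0 : 0 <= A by rewrite mulr_ge0 ?exprn_ge0.
have qX j : (j <= k)%N -> #|F|%:R ^+ (k - j) = #|F|%:R ^+ k * x ^+ j :> R.
  by move=> jk; rewrite -[in RHS](subnK jk) exprD -mulrA -exprMn qx expr1n mulr1.
pose cls := class_polys (k + t + ell) [set g | hayes_equiv ell Q f0 g].
have cardcls : #|cls| = (#|F| ^ k)%N by exact: card_class_polys.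
(* Bonferroni's inequality summed over the class, after clearing the denominator q^k. All orders r +
   i with i <= s = k - r stay within k, where the moments are known. *)
have sieve : `|prob_num_zeros R (k + t + ell) [set g | hayes_equiv ell Q f0 g] D r
    - A * \sum_(i < s) 'C(N, i)%:R * (- x) ^+ i| <= A * ('C(N, s)%:R * x ^+ s).
  rewrite /prob_num_zeros -/cls cardcls natrX.
  have Q0 : 0 < #|F|%:R ^+ k :> R by rewrite exprn_gt0.
  rewrite -(ler_pM2r Q0) -[X in `|_| * X]ger0_norm ?exprn_ge0// -normrM mulrBl.
  rewrite divfK ?gt_eqF//.
  have -> : #|[set f in cls | num_zeros D (f : {poly F}) == r]%SET|%:R
      = \sum_(f in cls) (num_zeros D (f : {poly F}) == r)%:R :> R.
    rewrite -sum1_card natr_sum big_mkcond [RHS]big_mkcond /=.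
    by apply: eq_bigr => f _; rewrite inE; case: (f \in cls) => //=; case: eqP.
  have -> : A * (\sum_(i < s) 'C(N, i)%:R * (- x) ^+ i) * #|F|%:R ^+ k
      = \sum_(f in cls) \sum_(i < s)
          ('C(num_zeros D (f : {poly F}), r)
           * 'C(num_zeros D (f : {poly F}) - r, i))%:R * (- 1) ^+ i.
    rewrite exchange_big mulr_sumr mulr_suml /=; apply: eq_bigr => i _.
    have rik : (r + i <= k)%N by rewrite -[leqRHS](subnKC rk) leq_add2l ltnW.
    rewrite -mulr_suml -natr_sum sum_bin_bin_num_zeros// !natrM natrX qX//.
    by rewrite /A -/n -/N exprD [(- x) ^+ i]exprNn; ring.
  rewrite -sumrB (le_trans (ler_norm_sum _ _ _))//.
  apply: (le_trans (ler_sum _ (fun f _ => bonferroni R _ _ _))).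
  rewrite -natr_sum sum_bin_bin_num_zeros ?subnKC//.
  rewrite natrM natrX qX// natrM /A -/n -/N -{2}(subnKC rk) -/s exprD.
  by rewrite le_eqVlt; apply/orP; left; apply/eqP; ring.
have bin : `|A * (1 - x) ^+ N - A * \sum_(i < s) 'C(N, i)%:R * (- x) ^+ i|
    <= A * ('C(N, s)%:R * x ^+ s).
  by rewrite -mulrBr normrM ger0_norm// ler_wpM2l// truncated_binomial ?x0.
have tail : A * ('C(N, s)%:R * x ^+ s) <= A * (s`!%:R)^-1.
  by rewrite ler_wpM2l// bin_expr_le.
(* The exponent (x + 2x^2) N equals (1 + 2x)(x N), at most 2 since x N <= 1 and x <= 1/2. This turns
   the absolute error into a relative one. *)
have low : expR (- 2) <= (1 - x) ^+ N.
  apply: le_trans (expR_le_expr_1sub N _); last by rewrite x0.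
  rewrite ler_expR mulNr lerN2 [leLHS](_ : _ = (1 + 2 * x) * (x * N%:R)); last by ring.
  have : (1 + 2 * x) * (x * N%:R) <= (1 + 2 * x) * 1 by rewrite ler_wpM2l//; lra.
  lra.
have {}low : 1 <= expR 2 * (1 - x) ^+ N.
  by rewrite -[leLHS](expRxMexpNx_1 (2 : R)) ler_wpM2l ?expR_ge0.
have -> : 2 * expR 2 / s`!%:R * p = 2 * (A * (s`!%:R)^-1) * (expR 2 * (1 - x) ^+ N).
  by rewrite /p -/A; ring.
apply: (@le_trans _ _ (2 * (A * (s`!%:R)^-1))); last first.
  by rewrite ler_peMr// mulr_ge0// mulr_ge0// invr_ge0.
rewrite /p -/A.
apply: le_trans (ler_distD (A * \sum_(i < s) 'C(N, i)%:R * (- x) ^+ i) _ _) _.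
rewrite [X in _ + X]distrC mulrDl mul1r lerD// ?(le_trans sieve)// (le_trans bin)//.
Qed.

Theorem theorem1 (R : realType) (F : nat -> finFieldType)
    (ell t k r : nat -> nat) (Q : forall i : nat, {poly F i})
    (eps : forall i : nat, set {poly F i}) (D : forall i : nat, {set F i})
    (Qmonic : forall i : nat, Q i \is monic)
    (Qdeg : forall i : nat, size (Q i) = (t i).+1)
    (epsP : forall i : nat, hayes_classes (ell i) (Q i) (eps i))
    (DQ : forall (i : nat) (a : F i), a \in D i -> ~~ root (Q i) a) :
  let q (i : nat) : R := #|F i|%:R in
  let n (i : nat) : nat := #|D i| in
  let prob (i : nat) : R :=
    prob_num_zeros R (k i + t i + ell i) (eps i) (D i) (r i) in
  ((fun i : nat => (k i)%:R - (r i)%:R : R) @ \oo --> +oo ->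
     prob ~_\oo
       (fun i : nat => 'C(n i, r i)%:R * (1 / q i) ^+ r i
                       * (1 - 1 / q i) ^+ (n i - r i)))
  /\
  ((fun i : nat => (n i)%:R : R) @ \oo --> +oo ->
   (fun i : nat => (k i)%:R - (r i)%:R : R) @ \oo --> +oo ->
   (fun i : nat => (r i)%:R : R) =o_\oo (fun i : nat => Num.sqrt (n i)%:R : R) ->
     prob ~_\oo
       (fun i : nat => expR (- ((n i)%:R / q i)) * (1 / (r i)`!%:R)
                       * ((n i)%:R / q i) ^+ r i)).
Proof.
move=> q n prob.
have q1 i : 1 < q i by rewrite ltr1n card_finNzRing_gt1.
have partA : (fun i : nat => (k i)%:R - (r i)%:R : R) @ \oo --> +oo ->
     prob ~_\oo
       (fun i : nat => 'C(n i, r i)%:R * (1 / q i) ^+ r i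
                       * (1 - 1 / q i) ^+ (n i - r i)).
  move=> /cvgryPge kr; apply: equiv_rel_error => e e0.
  near=> i; set p := _ * (1 - _) ^+ _.
  (* Since m <= m!, a large k - r already makes 2 e^2 / (k - r)! at most [e]. *)
  have krge : 2 * expR 2 / e <= (k i)%:R - (r i)%:R by near: i; exact: kr.
  have kr1 : 1 <= (k i)%:R - (r i)%:R :> R by near: i; exact: kr.
  have rk : (r i <= k i)%N by rewrite -(ler_nat R); lra.
  have p0 : 0 <= p.
    have qV : 1 / q i <= 1 by rewrite ler_pdivrMr ?mul1r ?ltW// (lt_trans _ (q1 i)).
    have qV0 : 0 <= 1 / q i by rewrite divr_ge0.
    by rewrite mulr_ge0 ?mulr_ge0 ?exprn_ge0 ?subr_ge0.
  have f0 : 0 < (k i - r i)`!%:R :> R by rewrite ltr0n fact_gt0.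
  rewrite (ger0_norm p0).
  apply: le_trans (prob_num_zeros_error R (Qmonic i) (Qdeg i) (epsP i) (@DQ i) rk) _.
  rewrite ler_wpM2r// ler_pdivrMr// [leRHS]mulrC -ler_pdivrMr// (le_trans krge)//.
  by rewrite -natrB// ler_nat fact_geq.
split=> // n_oo kr ro; apply: equiv_trans (partA kr) _.
(* From r <= d sqrt(n) and d <= 1 follows r^2 <= d n. Then d <= 1/2 gives 2 r^2 <= n, d <= e/4 gives
   2 r^2/n <= e/2, and n >= 4/e gives 2/n <= e/2. *)
apply: equiv_rel_error => e e0; set d := Num.min (2^-1) (e / 4).
have d0 : 0 < d by rewrite lt_min invr_gt0 ltr0n divr_gt0.
have de : d <= e / 4 by rewrite ge_min lexx orbT.
have d2 : d <= 2^-1 by rewrite ge_min lexx.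
move/cvgryPge : n_oo => n_oo; move/eqoP : ro => /(_ _ d0) ro.
near=> i.
have nge : 2 <= (n i)%:R :> R by near: i; exact: n_oo.
have nge' : 4 / e <= (n i)%:R :> R by near: i; exact: n_oo.
have n0 : 0 < (n i)%:R :> R by lra.
have rn : `|(r i)%:R : R| <= d * `|Num.sqrt (n i)%:R : R| by near: i.
have {}rn : (r i)%:R ^+ 2 <= d * (n i)%:R :> R.
  rewrite ger0_norm// ger0_norm ?sqrtr_ge0// in rn.
  have : (r i)%:R ^+ 2 <= (d * Num.sqrt (n i)%:R) ^+ 2 :> R.
    by rewrite lerXn2r// nnegrE// mulr_ge0 ?sqrtr_ge0// ltW.
  rewrite exprMn sqr_sqrtr// => /le_trans; apply; rewrite ler_wpM2r//.
  by rewrite expr2 ler_piMl ?ltW//; lra.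
have r2n : 2 * (r i)%:R ^+ 2 <= (n i)%:R :> R.
  have : d * (n i)%:R <= 2^-1 * (n i)%:R by rewrite ler_wpM2r.
  lra.
have q0 : 0 < q i by exact: lt_trans (q1 i).
have xn : 1 / q i * (n i)%:R <= 1.
  by rewrite mulrAC mul1r ler_pdivrMr// mul1r ler_nat max_card.
have rlen : (r i <= n i)%N.
  rewrite -(ler_nat R); case: (posnP (r i)) => [->//|r1].
  have : 1 * (r i)%:R <= (r i)%:R * (r i)%:R :> R by rewrite ler_wpM2r// ler1n.
  by move: r2n; rewrite expr2; lra.
have n1 : (1 < n i)%N by rewrite -(ltr_nat R); lra.
have x0 : 0 <= 1 / q i by rewrite divr_ge0// ltW.
have := binomial_poisson n1 rlen x0 xn r2n.
have -> : (n i)%:R * (1 / q i) = (n i)%:R / q i by rewrite mulrA mulr1.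
set c := expR _ * _ * _ => h.
have c0 : 0 <= c.
  by rewrite !mulr_ge0 ?expR_ge0 ?invr_ge0// exprn_ge0// divr_ge0// ltW.
apply: le_trans h _; rewrite ger0_norm// ler_wpM2r// [e in leRHS]splitr lerD//.
  by rewrite ler_pdivrMr//; have := ler_wpM2r (ltW n0) de; lra.
by rewrite ler_pdivrMr//; move: nge'; rewrite ler_pdivrMr//; lra.
Unshelve. all: by end_near.
Qed.
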